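(* Let $G$ be a profinite group, let $A$ be a $k$-local cofibrant commutative symmetric ring spectrum, and let $E$ be a $k$-local profinite $G$-Galois extension of $A$. Then $E$ is a discrete commutative $G$-$A$-algebra.
   Context: ''Spectrum'' means symmetric spectrum of simplicial sets. $k$ is a fixed spectrum and $(-)_k$ is Bousfield localization with respect to $k$; it is assumed that $(-)_k = ((-)_T)_M$, where $(-)_T$ is a smashing localization and $(-)_M$ is localization with respect to a finite spectrum $M$. For a profinite group $G$, a discrete $G$-spectrum is a symmetric spectrum of pointed simplicial discrete $G$-sets (every simplex has open stabilizer; the spheres $S^i$ have trivial $G$-action). A discrete $G$-$A$-module is a discrete $G$-spectrum with an $A$-module structure such that each $g\in G$ acts by an $A$-module map. A discrete commutative $G$-$A$-algebra is a discrete $G$-$A$-module $E$ together with a commutative $A$-algebra multiplication $E\wedge_A E\to E$ such that $G$ acts through maps of commutative $A$-algebras. For $G$ finite and $E$ a $k$-local cofibrant commutative $A$-algebra, $E$ is a $k$-local $G$-Galois extension of $A$ if $G$ acts on $E$ by commutative $A$-algebra maps, the canonical map $A\to E^{hG}$ is an equivalence, and the canonical map $(E\wedge_A E)_k\to \mathrm{Map}(G,E)$ (built from the action and the multiplication) is an equivalence. For $G$ profinite, a commutative $A$-algebra $E$ is a $k$-local profinite $G$-Galois extension of $A$ if: there is a directed system of finite $k$-local $G/U_\alpha$-Galois extensions $E_\alpha$ of $A$, for $\{U_\alpha\}$ a cofinal system of open normal subgroups of $G$; all maps $E_\alpha\to E_\beta$ are $G$-equivariant and are cofibrations of underlying commutative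 $A$-algebras; for $\alpha\le\beta$ the natural maps $E_\alpha\to E_\beta^{h(U_\alpha/U_\beta)}$ are equivalences; and $E$ is the filtered colimit $\operatorname{colim}_\alpha E_\alpha$ in commutative $A$-algebras, with the induced $G$-action. *)

(* Defs.v *)
From HB Require Import structures.
From mathcomp Require Import all_boot all_order all_fingroup.
From mathcomp Require Import boolp classical_sets topology.
From Stdlib Require Import Relation_Operators.
From Stdlib Require List.

Set Implicit Arguments.
Unset Strict Implicit.
Unset Printing Implicit Defensive.

Local Open Scope nat_scope.

HB.mixin Record isTopologicalGroup G of monoid.Group G & Topological G := {
  mulg_continuous : continuous (fun z : G * G => (z.1 * z.2)%g);
  invg_continuous : continuous (fun x : G => (x^-1)%g) }.

#[short(type="topologicalGroupType")]
HB.structure Definition TopologicalGroup :=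
  {G of isTopologicalGroup G & monoid.Group G & Topological G}.

HB.mixin Record isProfinite G of TopologicalGroup G := {
  profinite_compact : compact [set: G]%classic;
  profinite_hausdorff : hausdorff_space G;
  profinite_totally_disconnected : totally_disconnected [set: G]%classic }.

#[short(type="profiniteGroupType")]
HB.structure Definition ProfiniteGroup :=
  {G of isProfinite G & TopologicalGroup G}.

Definition normal_subgroup (G : groupType) (U : set G) : Prop :=
  [/\ U 1%g,
      forall x y, U x -> U y -> U (x * y)%g,
      forall x, U x -> U (x^-1)%g
    & forall x g, U x -> U (g * x * g^-1)%g].

(* [Q], together with the projection [pi], is the quotient group [G / U]. *)
Definition is_quotient (G : groupType) (U : set G) (Q : groupType)
    (pi : {multiplicative G -> Q}) : Prop :=
  (forall q, exists g, pi g = q) /\ (forall g, pi g = 1%g <-> U g).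

Definition monotone m n (f : {ffun 'I_m.+1 -> 'I_n.+1}) :=
  [forall i : 'I_m.+1, forall j : 'I_m.+1, (i <= j) ==> (f i <= f j)].

(* [delta m n] is the set of morphisms [[m] -> [n]] of the simplex category. *)
Record delta m n := Delta {
  dfun :> {ffun 'I_m.+1 -> 'I_n.+1};
  dfunP : monotone dfun }.
HB.instance Definition _ m n := [isSub for @dfun m n].

Lemma dmono m n (f : delta m n) (i j : 'I_m.+1) : i <= j -> f i <= f j.
Proof. by have /forallP/(_ i)/forallP/(_ j)/implyP := dfunP f. Qed.

Lemma deltaP m n (f g : delta m n) : f =1 g -> f = g.
Proof. by move=> fg; apply/val_inj/ffunP. Qed.

Fact did_subproof m : monotone [ffun i : 'I_m.+1 => i].
Proof. by apply/forallP=> i; apply/forallP=> j; rewrite !ffunE; apply/implyP. Qed.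
Definition did m : delta m m := Delta (did_subproof m).

Fact dcomp_subproof m n p (f : delta n p) (g : delta m n) :
  monotone [ffun i => f (g i)].
Proof.
by apply/forallP=> i; apply/forallP=> j; rewrite !ffunE; apply/implyP=> ij; do 2!apply: dmono.
Qed.
Definition dcomp m n p (f : delta n p) (g : delta m n) : delta m p :=
  Delta (dcomp_subproof f g).

Fact coface_subproof n (k : 'I_n.+2) : monotone [ffun i : 'I_n.+1 => lift k i].
Proof.
apply/forallP=> i; apply/forallP=> j; rewrite !ffunE; apply/implyP=> ij.
by rewrite /= leq_bump2.
Qed.
Definition coface n (k : 'I_n.+2) : delta n n.+1 := Delta (coface_subproof k).

Fact dcst_subproof m n (k : 'I_n.+1) : monotone [ffun _ : 'I_m.+1 => k].
Proof. by apply/forallP=> i; apply/forallP=> j; rewrite !ffunE leqnn implybT. Qed.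
Definition dcst m n (k : 'I_n.+1) : delta m n := Delta (dcst_subproof m k).

Lemma dcomp1f m n (f : delta m n) : dcomp (did n) f = f.
Proof. by apply: deltaP => i; rewrite /= !ffunE. Qed.
Lemma dcompf1 m n (f : delta m n) : dcomp f (did m) = f.
Proof. by apply: deltaP => i; rewrite /= !ffunE. Qed.
Lemma dcompA m n p q (f : delta p q) (g : delta n p) (h : delta m n) :
  dcomp f (dcomp g h) = dcomp (dcomp f g) h.
Proof. by apply: deltaP => i; rewrite /= !ffunE. Qed.
Lemma dcomp_cst m n p (k : 'I_p.+1) (g : delta m n) :
  dcomp (dcst n k) g = dcst m k.
Proof. by apply: deltaP => i; rewrite /= !ffunE. Qed.

(* The simplicial circle is [Delta[1] / dDelta[1]]: its [m]-simplices are the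
   [t : delta m 1], those lying in the boundary, i.e. the constant ones, being
   identified with the base point. *)
Definition in_boundary m (t : delta m 1) : Prop := exists k, t = dcst m k.

Record sset := SSet {
  simp :> nat -> Type;
  sact : forall m n, delta m n -> simp n -> simp m;
  sact1 : forall m (x : simp m), sact (did m) x = x;
  sactM : forall m n p (f : delta n p) (g : delta m n) (x : simp p),
    sact (dcomp f g) x = sact g (sact f x) }.
Arguments sact {s m n}.

Record smap (X Y : sset) := SMap {
  smfun :> forall m, X m -> Y m;
  smapP : forall m n (f : delta m n) x, smfun (sact f x) = sact f (smfun x) }.

(* A map [X x Delta[1] -> K]; these generate the relation with quotient
   [pi_0 Map(X, K)]. *)
Definition shomotopy (X K : sset) (f g : smap X K) : Prop :=
  exists H : forall m, X m -> delta m 1 -> K m,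
    [/\ forall m n (d : delta m n) x t,
          H m (sact d x) (dcomp t d) = sact d (H n x t),
        forall m x, H m x (dcst m ord0) = f m x
      & forall m x, H m x (dcst m ord_max) = g m x].

Definition shomotopic (X K : sset) : smap X K -> smap X K -> Prop :=
  clos_refl_sym_trans _ (@shomotopy X K).

(* Right lifting property against all horns [Lambda^k[n+1] -> Delta[n+1]]; a
   horn in [X] is given by its faces [x i], [i != k]. *)
Definition kan_fibration (X Y : sset) (p : smap X Y) : Prop :=
  forall n (k : 'I_n.+2) (x : 'I_n.+2 -> X n) (y : Y n.+1),
    (forall (i j : 'I_n.+2) m (a b : delta m n), i != k -> j != k ->
       dcomp (coface i) a = dcomp (coface j) b -> sact a (x i) = sact b (x j)) ->
    (forall i, i != k -> sact (coface i) y = p _ (x i)) ->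
    exists z : X n.+1,
      (forall i, i != k -> sact (coface i) z = x i) /\ p _ z = y.

Definition point_sset : sset :=
  @SSet (fun=> unit) (fun _ _ _ x => x) (fun _ _ => erefl) (fun _ _ _ _ _ _ => erefl).

Definition to_point (X : sset) : smap X point_sset :=
  @SMap X point_sset (fun _ _ => tt) (fun _ _ _ _ => erefl).

Definition kan_complex (X : sset) : Prop := kan_fibration (to_point X).

Fact smap_comp_subproof (X Y Z : sset) (g : smap Y Z) (f : smap X Y) m n
  (d : delta m n) x : g _ (f _ (sact d x)) = sact d (g _ (f _ x)).
Proof. by rewrite !smapP. Qed.
Definition smap_comp (X Y Z : sset) (g : smap Y Z) (f : smap X Y) : smap X Z :=
  SMap (smap_comp_subproof g f).

(* [f] is a weak equivalence when [pi_0 Map(Y, K) -> pi_0 Map(X, K)] is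
   bijective for all Kan complexes [K]. *)
Definition weak_equiv (X Y : sset) (f : smap X Y) : Prop :=
  forall K, kan_complex K ->
    (forall u v : smap Y K,
       shomotopic (smap_comp u f) (smap_comp v f) -> shomotopic u v) /\
    (forall u : smap X K, exists v : smap Y K, shomotopic (smap_comp v f) u).

Definition trivial_fibration (X Y : sset) (p : smap X Y) : Prop :=
  kan_fibration p /\ weak_equiv p.

Definition simplexwise_injective (X Y : sset) (f : smap X Y) : Prop :=
  forall m x y, f m x = f m y -> x = y.

Record psset := PSSet {
  psset_sset :> sset;
  pt : forall m, psset_sset m;
  sact_pt : forall m n (d : delta m n), sact d (pt n) = pt m }.
Arguments pt {p m}.

Definition pointed_map (X Y : psset) (f : smap X Y) : Prop :=
  forall m, f m pt = pt.

(* The two-point simplicial set [S^0]. *)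
Definition S0 : psset :=
  @PSSet (@SSet (fun=> bool) (fun _ _ _ x => x) (fun _ _ => erefl)
           (fun _ _ _ _ _ _ => erefl))
    (fun=> false) (fun _ _ _ => erefl).

(* Finitely many simplices generate [X]. *)
Definition finite_sset (X : sset) : Prop :=
  exists s : seq {m & X m}, forall n (x : X n),
    exists y (d : delta n (projT1 y)), List.In y s /\ x = sact d (projT2 y).

Section Loops.
Variable Y : psset.

(* An [m]-simplex of [Omega Y = Map(S^1, Y)] is a pointed map
   [Delta[m]_+ /\ S^1 -> Y]. *)
Definition loop_prop m (h : forall j, delta j m -> delta j 1 -> Y j) : Prop :=
  (forall i j (d : delta i j) a t,
     h i (dcomp a d) (dcomp t d) = sact d (h j a t)) /\
  (forall j a t, in_boundary t -> h j a t = pt).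

Definition loop_simp m := {h | @loop_prop m h}.

Fact loop_act_subproof m n (f : delta m n) (h : loop_simp n) :
  loop_prop (fun j a t => sval h j (dcomp f a) t).
Proof.
by case: h => h [/= hn hp]; split=> [i j d a t|j a t /hp //]; rewrite dcompA hn.
Qed.

Definition loop_act m n (f : delta m n) (h : loop_simp n) : loop_simp m :=
  exist _ _ (loop_act_subproof f h).

Lemma loop_eq m (h k : loop_simp m) :
  (forall j a t, sval h j a t = sval k j a t) -> h = k.
Proof.
case: h k => [h hP] [k kP] /= hk.
have E : h = k by apply: functional_extensionality_dep => j; do 2!apply: funext => ?.
by case: _ / E kP {hk} => kP; congr exist; apply: Prop_irrelevance.
Qed.

Fact loop_act1 m (h : loop_simp m) : loop_act (did m) h = h.
Proof. by apply: loop_eq => j a t /=; rewrite dcomp1f. Qed.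
Fact loop_actM m n p (f : delta n p) (g : delta m n) (h : loop_simp p) :
  loop_act (dcomp f g) h = loop_act g (loop_act f h).
Proof. by apply: loop_eq => j a t /=; rewrite dcompA. Qed.

Definition Omega : sset := SSet loop_act1 loop_actM.

End Loops.

(* [t * r] acting on the first [p] and the last [n] elements of [p + n]. *)
Section Permutations.
Variables p n : nat.

Definition block_fun (t : 'S_p) (r : 'S_n) (i : 'I_(p + n)) : 'I_(p + n) :=
  match split i with
  | inl a => lshift n (t a)
  | inr b => rshift p (r b)
  end.

Fact block_inj t r : injective (block_fun t r).
Proof.
apply: (can_inj (g := block_fun t^-1 r^-1)) => i; rewrite /block_fun.
case: (splitP i) => [a|b] Ei.
  rewrite (_ : split (lshift n _) = inl (t a)); last exact: (unsplitK (inl _)).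
  by apply: val_inj; rewrite permK /= Ei.
rewrite (_ : split (rshift p _) = inr (r b)); last exact: (unsplitK (inr _)).
by apply: val_inj; rewrite permK /= Ei.
Qed.

Definition block t r : 'S_(p + n) := perm (@block_inj t r).

(* The shuffle moving the first [p] elements of [p + n] past the last [n], read
   on [n + p] through the equality [p + n = n + p]. *)
Definition chi_fun (i : 'I_(n + p)) : 'I_(n + p) :=
  match split (cast_ord (addnC n p) i) with
  | inl a => rshift n a
  | inr b => lshift p b
  end.

Fact chi_inj : injective chi_fun.
Proof.
move=> i j; rewrite /chi_fun.
case: (splitP (cast_ord _ i)) => a Ea; case: (splitP (cast_ord _ j)) => b Eb /(congr1 val)/= E;
  apply: val_inj.
- by move: Ea Eb => /= -> ->; apply/eqP; rewrite -(eqn_add2l n); apply/eqP.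
- by move: (ltn_ord b); rewrite -E ltnNge leq_addr.
- by move: (ltn_ord a); rewrite E ltnNge leq_addr.
- by move: Ea Eb => /= -> ->; rewrite E.
Qed.

Definition chi : 'S_(n + p) := perm chi_inj.

End Permutations.

(* [S^p /\ L_n -> L_{p+n}] iterated from [S^1 /\ L_n -> L_{1+n}]. *)
Fixpoint sigma_iter (T : Type) (L : nat -> Type)
    (sigma : forall n, T -> L n -> L n.+1) p n :
    ('I_p -> T) -> L n -> L (p + n) :=
  match p with
  | 0 => fun _ x => x
  | p'.+1 => fun t x =>
      sigma (p' + n) (t ord0) (sigma_iter sigma (fun i => t (lift ord0 i)) x)
  end.

(* [sperm] is a left action: in ['S_n], [s * t] is [t] after [s].  The structure
   maps [S^1 /\ X_n -> X_{n+1}] are given by their restrictions to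
   [Delta[1] x X_n]. *)
Record symSpec := SymSpec {
  lev :> nat -> psset;
  sperm : forall n m, 'S_n -> lev n m -> lev n m;
  sigma : forall n m, delta m 1 -> lev n m -> lev n.+1 m;
  sperm_nat : forall n m m' (d : delta m m') s (x : lev n m'),
    sperm s (sact d x) = sact d (sperm s x);
  sperm_pt : forall n m s, sperm s pt = pt :> lev n m;
  sperm1 : forall n m (x : lev n m), sperm 1%g x = x;
  spermM : forall n m s t (x : lev n m),
    sperm (s * t)%g x = sperm t (sperm s x);
  sigma_nat : forall n m m' (d : delta m m') t (x : lev n m'),
    sigma (dcomp t d) (sact d x) = sact d (sigma t x);
  sigma_pt : forall n m t, sigma t pt = pt :> lev n.+1 m;
  sigma_boundary : forall n m t (x : lev n m), in_boundary t -> sigma t x = pt;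
  sigma_equiv : forall p n m (t : 'I_p -> delta m 1) (r : 'S_p) (s : 'S_n)
      (x : lev n m),
    sigma_iter (L := fun k => lev k m) (fun k => @sigma k m)
      (fun i => t ((r^-1)%g i)) (sperm s x)
    = sperm (block r s)
        (sigma_iter (L := fun k => lev k m) (fun k => @sigma k m) t x) }.
Arguments sperm {X n m} : rename.
Arguments sigma {X n m} : rename.

(* Transport along an equality of levels. *)
Definition lcast (X : symSpec) m n n' (e : n = n') (x : X n m) : X n' m :=
  ecast k (X k m) e x.

Definition twist (X : symSpec) p q m (x : X (p + q) m) : X (q + p) m :=
  sperm (chi p q) (lcast (addnC p q) x).

Record specMap (X Y : symSpec) := SpecMap {
  mfun :> forall n m, X n m -> Y n m;
  mfun_nat : forall n m m' (d : delta m m') (x : X n m'),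
    mfun (sact d x) = sact d (mfun x);
  mfun_pt : forall n m, mfun pt = pt :> Y n m;
  mfun_perm : forall n m s (x : X n m), mfun (sperm s x) = sperm s (mfun x);
  mfun_sigma : forall n m t (x : X n m),
    mfun (sigma t x) = sigma t (mfun x) }.

Definition lev_map (X Y : symSpec) (f : specMap X Y) n : smap (X n) (Y n) :=
  @SMap (X n) (Y n) (f n) (@mfun_nat _ _ f n).

Section Comp.
Variables (X Y Z : symSpec) (g : specMap Y Z) (f : specMap X Y).
Let h n m (x : X n m) := g _ _ (f _ _ x).
Fact comp_nat n m m' (d : delta m m') (x : X n m') : h (sact d x) = sact d (h x).
Proof. by rewrite /h !mfun_nat. Qed.
Fact comp_pt n m : h pt = pt :> Z n m.
Proof. by rewrite /h !mfun_pt. Qed.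
Fact comp_perm n m s (x : X n m) : h (sperm s x) = sperm s (h x).
Proof. by rewrite /h !mfun_perm. Qed.
Fact comp_sigma n m t (x : X n m) : h (sigma t x) = sigma t (h x).
Proof. by rewrite /h !mfun_sigma. Qed.
Definition spec_comp : specMap X Z := SpecMap comp_nat comp_pt comp_perm comp_sigma.
End Comp.

Definition level_equiv (X Y : symSpec) (f : specMap X Y) : Prop :=
  forall n, weak_equiv (lev_map f n).

Definition level_injective (X Y : symSpec) (f : specMap X Y) : Prop :=
  forall n, simplexwise_injective (lev_map f n).

Definition injective_spectrum (Z : symSpec) : Prop :=
  forall (X Y : symSpec) (i : specMap X Y), level_injective i -> level_equiv i ->
    forall f : specMap X Z, exists g : specMap Y Z,
      forall n m x, g n m (i n m x) = f n m x.

Fact sigma_adj_subproof (X : symSpec) n m (x : X n m) :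
  loop_prop (Y := X n.+1) (fun j (a : delta j m) t => sigma t (sact a x)).
Proof.
split=> [i j d a t|j a t tB]; last exact: sigma_boundary.
by rewrite sactM sigma_nat.
Qed.

Fact sigma_adj_nat (X : symSpec) n m m' (d : delta m m') (x : X n m') :
  exist _ _ (sigma_adj_subproof (sact d x))
  = sact (s := Omega (X n.+1)) d (exist _ _ (sigma_adj_subproof x)).
Proof. by apply: loop_eq => j a t /=; rewrite sactM. Qed.

Definition sigma_adj (X : symSpec) n : smap (X n) (Omega (X n.+1)) :=
  @SMap (X n) (Omega (X n.+1)) (fun m x => exist _ _ (sigma_adj_subproof x))
    (@sigma_adj_nat X n).

Definition omega_spectrum (X : symSpec) : Prop :=
  forall n, kan_complex (X n) /\ weak_equiv (sigma_adj X n).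

(* A map [X /\ Delta[1]_+ -> Z]. *)
Definition homotopy (X Z : symSpec) (f g : specMap X Z) : Prop :=
  exists H : forall n m, X n m -> delta m 1 -> Z n m,
    [/\ forall n m m' (d : delta m m') x t,
          H n m (sact d x) (dcomp t d) = sact d (H n m' x t),
        forall n m t, H n m pt t = pt,
        forall n m s x t, H n m (sperm s x) t = sperm s (H n m x t),
        forall n m u x t, H n.+1 m (sigma u x) t = sigma u (H n m x t)
      & (forall n m x, H n m x (dcst m ord0) = f n m x) /\
        (forall n m x, H n m x (dcst m ord_max) = g n m x)].

Definition homotopic (X Z : symSpec) : specMap X Z -> specMap X Z -> Prop :=
  clos_refl_sym_trans _ (@homotopy X Z).

(* [pi_0 Map(Y, Z) -> pi_0 Map(X, Z)] is bijective. *)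
Definition pi0_bij (X Y : symSpec) (f : specMap X Y) (Z : symSpec) : Prop :=
  (forall u v : specMap Y Z,
     homotopic (spec_comp u f) (spec_comp v f) -> homotopic u v) /\
  (forall u : specMap X Z, exists v : specMap Y Z, homotopic (spec_comp v f) u).

(* In the sense of Hovey, Shipley and Smith: [E^0 f] is bijective for every
   injective Omega-spectrum [E]. *)
Definition stable_equiv (X Y : symSpec) (f : specMap X Y) : Prop :=
  forall Z, injective_spectrum Z -> omega_spectrum Z -> pi0_bij f Z.

(* The trivial fibrations of the stable model structure are the levelwise ones. *)
Definition cofibrant_spectrum (X : symSpec) : Prop :=
  forall (Y Z : symSpec) (p : specMap Y Z),
    (forall n, trivial_fibration (lev_map p n)) ->
    forall f : specMap X Z, exists g : specMap X Y,
      forall n m x, p n m (g n m x) = f n m x.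

(* A bimorphism [X, Y -> Z] is a map [X /\ Y -> Z] of symmetric spectra. The
   last condition is linearity over the sphere spectrum in the second variable,
   after exchanging the two variables. *)
Record bimorph (X Y Z : symSpec) := Bimorph {
  bfun : forall p q m, X p m -> Y q m -> Z (p + q) m;
  bfun_nat : forall p q m m' (d : delta m m') (x : X p m') (y : Y q m'),
    bfun (sact d x) (sact d y) = sact d (bfun x y);
  bfun_ptl : forall p q m (y : Y q m), bfun (pt : X p m) y = pt;
  bfun_ptr : forall p q m (x : X p m), bfun x (pt : Y q m) = pt;
  bfun_perm : forall p q m s r (x : X p m) (y : Y q m),
    bfun (sperm s x) (sperm r y) = sperm (block s r) (bfun x y);
  bfun_sigmal : forall p q m t (x : X p m) (y : Y q m),
    bfun (sigma t x) y = sigma t (bfun x y) :> Z (p + q).+1 m;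
  bfun_sigmar : forall p q m t (x : X p m) (y : Y q m),
    twist (bfun x (sigma t y)) = sigma t (twist (bfun x y)) :> Z (q + p).+1 m }.

(* [P], with [b], is the smash product [X /\ Y]. *)
Definition is_smash (X Y P : symSpec) (b : bimorph X Y P) : Prop :=
  forall (Z : symSpec) (c : bimorph X Y Z),
    exists2 h : specMap P Z,
      forall p q m (x : X p m) (y : Y q m), h _ _ (bfun b x y) = bfun c x y
    & forall h' : specMap P Z,
        (forall p q m (x : X p m) (y : Y q m), h' _ _ (bfun b x y) = bfun c x y) ->
        forall n m x, h' n m x = h n m x.

(* [P], with [u : K -> P_n], is the free symmetric spectrum [F_n K]. *)
Definition is_free (n : nat) (K : psset) (P : symSpec) (u : smap K (P n)) : Prop :=
  pointed_map u /\
  forall (Z : symSpec) (c : smap K (Z n)), pointed_map c ->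
    exists2 h : specMap P Z,
      forall m x, h _ _ (u m x) = c m x
    & forall h' : specMap P Z,
        (forall m x, h' _ _ (u m x) = c m x) ->
        forall n m x, h' n m x = h n m x.

(* [W /\ f : W /\ X -> W /\ Y]. *)
Definition is_smash_map (W X Y : symSpec) (f : specMap X Y)
    (P P' : symSpec) (b : bimorph W X P) (b' : bimorph W Y P')
    (h : specMap P P') : Prop :=
  [/\ is_smash b, is_smash b'
    & forall p q m (w : W p m) (x : X q m), h _ _ (bfun b w x) = bfun b' w (f _ _ x)].

(* The smash product with [k] is the derived one, hence the cofibrant
   replacement [kc]. *)
Definition local_equiv (k X Y : symSpec) (f : specMap X Y) : Prop :=
  exists (kc : symSpec) (w : specMap kc k) (P P' : symSpec)
    (b : bimorph kc X P) (b' : bimorph kc Y P') (h : specMap P P'),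
    [/\ cofibrant_spectrum kc, stable_equiv w, is_smash_map f b b' h
      & stable_equiv h].

(* Every [k]-equivalence [W -> W'] induces a bijection [[W', X] -> [W, X]] in
   the stable homotopy category, computed by a fibrant replacement of [X]. *)
Definition local (k X : symSpec) : Prop :=
  exists (Z : symSpec) (j : specMap X Z),
    [/\ stable_equiv j, injective_spectrum Z, omega_spectrum Z
      & forall (W W' : symSpec) (f : specMap W W'), local_equiv k f -> pi0_bij f Z].

Definition is_localization (k X Y : symSpec) (l : specMap X Y) : Prop :=
  local_equiv k l /\ local k Y.

(* For the sphere spectrum [S = F_0 S^0] and its localization [eta : S -> ST],
   the map [X = X /\ S -> X /\ ST] is a localization of [X] with respect to [T];
   it is enough to consider cofibrant [X], for which [X /\ ST] is the derived
   smash product. *)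
Definition smashing (T : symSpec) : Prop :=
  exists (S : symSpec) (u : smap S0 (S 0)) (ST : symSpec) (eta : specMap S ST),
    [/\ is_free u, is_localization T eta
      & forall X, cofibrant_spectrum X ->
          exists (P P' : symSpec) (b : bimorph X S P) (b' : bimorph X ST P')
            (h : specMap P P'),
            is_smash_map eta b b' h /\ is_localization T h].

(* [M] is stably equivalent to a desuspension [F_n K] of the suspension spectrum
   of a finite complex [K]. *)
Definition finite_spectrum (M : symSpec) : Prop :=
  exists (n : nat) (K : psset) (F : symSpec) (u : smap K (F n)) (M' : symSpec)
    (f : specMap F M') (g : specMap M M'),
    [/\ finite_sset K, is_free u, stable_equiv f & stable_equiv g].

(* [(-)_k = ((-)_T)_M]. *)
Definition composite_localization (k T M : symSpec) : Prop :=
  forall (X Y Z : symSpec) (l : specMap X Y) (l' : specMap Y Z),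
    is_localization T l -> is_localization M l' ->
    is_localization k (spec_comp l' l).

(* The unit [S -> A] is given by the corresponding map [* -> A_0]. *)
Record commRing := CommRing {
  ring_spec :> symSpec;
  rmul : bimorph ring_spec ring_spec ring_spec;
  rone : forall m, ring_spec 0 m;
  rone_nat : forall m m' (d : delta m m'), sact d (rone m') = rone m;
  rmul1 : forall p m (x : ring_spec p m), bfun rmul (rone m) x = x;
  rmulA : forall p q r m (x : ring_spec p m) (y : ring_spec q m) (z : ring_spec r m),
    bfun rmul (bfun rmul x y) z
    = lcast (addnA p q r) (bfun rmul x (bfun rmul y z));
  rmulC : forall p q m (x : ring_spec p m) (y : ring_spec q m),
    bfun rmul y x = twist (bfun rmul x y) }.
Arguments rmul {c}.
Arguments rone {c m}.

Record module (A : commRing) := Module {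
  module_spec :> symSpec;
  mact : bimorph A module_spec module_spec;
  mact1 : forall p m (x : module_spec p m), bfun mact rone x = x;
  mactA : forall p q r m (a : A p m) (b : A q m) (x : module_spec r m),
    bfun mact (bfun rmul a b) x
    = lcast (addnA p q r) (bfun mact a (bfun mact b x)) }.
Arguments mact {A M} : rename.

(* A commutative monoid for the smash product over [A]: by commutativity of
   the product, its linearity [amulZ] over [A] in the first variable entails
   linearity in the second one. *)
Record commAlg (A : commRing) := CommAlg {
  alg_module :> module A;
  amul : bimorph alg_module alg_module alg_module;
  aone : forall m, alg_module 0 m;
  aone_nat : forall m m' (d : delta m m'), sact d (aone m') = aone m;
  amul1 : forall p m (x : alg_module p m), bfun amul (aone m) x = x;
  amulA : forall p q r m (x : alg_module p m) (y : alg_module q m)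
      (z : alg_module r m),
    bfun amul (bfun amul x y) z
    = lcast (addnA p q r) (bfun amul x (bfun amul y z));
  amulC : forall p q m (x : alg_module p m) (y : alg_module q m),
    bfun amul y x = twist (bfun amul x y);
  amulZ : forall p q r m (a : A p m) (x : alg_module q m) (y : alg_module r m),
    bfun amul (bfun mact a x) y
    = lcast (addnA p q r) (bfun mact a (bfun amul x y)) }.
Arguments amul {A c}.
Arguments aone {A c m}.

Definition is_ring_map (R R' : commRing) (f : specMap R R') : Prop :=
  (forall p q m (x : R p m) (y : R q m),
     f _ _ (bfun rmul x y) = bfun rmul (f _ _ x) (f _ _ y)) /\
  (forall m, f 0 m rone = rone).

Definition is_module_map A (M N : module A) (f : specMap M N) : Prop :=
  forall p q m (a : A p m) (x : M q m), f _ _ (bfun mact a x) = bfun mact a (f _ _ x).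

Definition is_alg_map A (E F : commAlg A) (f : specMap E F) : Prop :=
  [/\ is_module_map f,
      forall p q m (x : E p m) (y : E q m),
        f _ _ (bfun amul x y) = bfun amul (f _ _ x) (f _ _ y)
    & forall m, f 0 m aone = aone].

(* The unit [A -> E], [a |-> a 1]. *)
Definition is_unit_map A (E : commAlg A) (f : specMap A E) : Prop :=
  forall n m (a : A n m), f _ _ a = lcast (addn0 n) (bfun mact a aone).

(* The trivial fibrations of the positive stable model structures on commutative
   ring spectra and on commutative [A]-algebras; cofibrations are the maps with
   the left lifting property against them. *)
Definition positive_trivial_fibration (X Y : symSpec) (p : specMap X Y) : Prop :=
  forall n, 0 < n -> trivial_fibration (lev_map p n).

Definition cofibrant_ring (A : commRing) : Prop :=
  forall (X Y : commRing) (p : specMap X Y),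
    is_ring_map p -> positive_trivial_fibration p ->
    forall f : specMap A Y, is_ring_map f ->
      exists2 g : specMap A X, is_ring_map g
        & forall n m x, p n m (g n m x) = f n m x.

Definition alg_cofibration A (E F : commAlg A) (i : specMap E F) : Prop :=
  is_alg_map i /\
  forall (X Y : commAlg A) (p : specMap X Y),
    is_alg_map p -> positive_trivial_fibration p ->
    forall (f : specMap E X) (g : specMap F Y), is_alg_map f -> is_alg_map g ->
      (forall n m x, p n m (f n m x) = g n m (i n m x)) ->
      exists h : specMap F X,
        [/\ is_alg_map h, forall n m x, h n m (i n m x) = f n m x
          & forall n m x, p n m (h n m x) = g n m x].

(* [A] is the initial commutative [A]-algebra. *)
Definition cofibrant_alg A (E : commAlg A) : Prop :=
  forall (X Y : commAlg A) (p : specMap X Y),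
    is_alg_map p -> positive_trivial_fibration p ->
    forall f : specMap E Y, is_alg_map f ->
      exists2 g : specMap E X, is_alg_map g
        & forall n m x, p n m (g n m x) = f n m x.

(* [P], with [b], is the smash product [E /\_A E]: [b] is universal among the
   bimorphisms with [b (x a) y = b x (a y)], where [x a] stems from the left
   action of [A]. *)
Definition balanced A (M N : module A) (P : symSpec) (b : bimorph M N P) : Prop :=
  forall p q r m (x : M p m) (a : A q m) (y : N r m),
    bfun b (twist (bfun mact a x)) y
    = lcast (addnA p q r) (bfun b x (bfun mact a y)).

Definition is_smash_over A (M N : module A) (P : symSpec) (b : bimorph M N P) : Prop :=
  balanced b /\
  forall (Z : symSpec) (c : bimorph M N Z), balanced c ->
    exists2 h : specMap P Z,
      forall p q m (x : M p m) (y : N q m), h _ _ (bfun b x y) = bfun c x y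
    & forall h' : specMap P Z,
        (forall p q m (x : M p m) (y : N q m), h' _ _ (bfun b x y) = bfun c x y) ->
        forall n m x, h' n m x = h n m x.

Section Actions.
Variables (G : groupType) (X : symSpec) (rho : G -> specMap X X).

Definition is_action : Prop :=
  (forall n m x, rho 1%g n m x = x) /\
  (forall g h n m x, rho (g * h)%g n m x = rho g n m (rho h n m x)).

Definition fixed n m (x : X n m) : Prop := forall g, rho g _ _ x = x.

Definition fix_simp n m := {x : X n m | fixed x}.

Lemma fix_eq n m (x y : fix_simp n m) : sval x = sval y -> x = y.
Proof.
by case: x y => [x xP] [y yP] /= E; subst; congr exist; apply: Prop_irrelevance.
Qed.

Fact fix_act_subproof n m m' (d : delta m m') (x : fix_simp n m') :
  fixed (sact d (sval x)).
Proof. by move=> g; rewrite mfun_nat (svalP x). Qed.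
Definition fix_act n m m' (d : delta m m') (x : fix_simp n m') : fix_simp n m :=
  exist _ _ (fix_act_subproof d x).

Fact fix_act1 n m (x : fix_simp n m) : fix_act (did m) x = x.
Proof. by apply: fix_eq; rewrite /= sact1. Qed.
Fact fix_actM n m m' m'' (f : delta m' m'') (g : delta m m') (x : fix_simp n m'') :
  fix_act (dcomp f g) x = fix_act g (fix_act f x).
Proof. by apply: fix_eq; rewrite /= sactM. Qed.
Definition fix_sset n : sset := SSet (@fix_act1 n) (@fix_actM n).

Fact fix_pt_subproof n m : fixed (pt : X n m).
Proof. by move=> g; rewrite mfun_pt. Qed.
Definition fix_pt n m : fix_sset n m := exist _ _ (fix_pt_subproof n m).
Fact fix_act_pt n m m' (d : delta m m') : sact d (fix_pt n m') = fix_pt n m.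
Proof. by apply: fix_eq; rewrite /= sact_pt. Qed.
Definition fix_psset n : psset := PSSet (@fix_act_pt n).

Fact fix_perm_subproof n m s (x : fix_simp n m) : fixed (sperm s (sval x)).
Proof. by move=> g; rewrite mfun_perm (svalP x). Qed.
Definition fix_perm n m s (x : fix_psset n m) : fix_psset n m :=
  exist _ _ (fix_perm_subproof s x).

Fact fix_sigma_subproof n m t (x : fix_simp n m) : fixed (sigma t (sval x)).
Proof. by move=> g; rewrite mfun_sigma (svalP x). Qed.
Definition fix_sigma n m t (x : fix_psset n m) : fix_psset n.+1 m :=
  exist _ _ (fix_sigma_subproof t x).

Fact fix_sigma_iter p n m (t : 'I_p -> delta m 1) (x : fix_psset n m) :
  sval (sigma_iter (L := fun k => fix_psset k m) (fun k => @fix_sigma k m) t x)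
  = sigma_iter (L := fun k => X k m) (fun k => @sigma X k m) t (sval x).
Proof. by elim: p t => [|p IHp] t //=; rewrite IHp. Qed.

(* The fixed points [X^G]. *)
Definition fix_spec : symSpec.
Proof.
refine (@SymSpec fix_psset fix_perm fix_sigma _ _ _ _ _ _ _ _).
- by move=> n m m' d s x; apply: fix_eq; rewrite /= sperm_nat.
- by move=> n m s; apply: fix_eq; rewrite /= sperm_pt.
- by move=> n m x; apply: fix_eq; rewrite /= sperm1.
- by move=> n m s t x; apply: fix_eq; rewrite /= spermM.
- by move=> n m m' d t x; apply: fix_eq; rewrite /= sigma_nat.
- by move=> n m t; apply: fix_eq; rewrite /= sigma_pt.
- by move=> n m t x tB; apply: fix_eq; rewrite /= sigma_boundary.
- move=> p n m t r s x; apply: fix_eq.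
  by rewrite fix_sigma_iter /= sigma_equiv fix_sigma_iter.
Defined.

(* [X_n] is fibrant among simplicial [G]-sets, where the weak equivalences and
   the cofibrations are the underlying ones, and [X] is an Omega-spectrum. *)
Definition equivariantly_fibrant : Prop :=
  omega_spectrum X /\
  forall n (K L : sset) (aK : G -> smap K K) (aL : G -> smap L L) (i : smap K L),
    (forall m x, aK 1%g m x = x) ->
    (forall g h m x, aK (g * h)%g m x = aK g m (aK h m x)) ->
    (forall m x, aL 1%g m x = x) ->
    (forall g h m x, aL (g * h)%g m x = aL g m (aL h m x)) ->
    (forall g m x, i m (aK g m x) = aL g m (i m x)) ->
    simplexwise_injective i -> weak_equiv i ->
    forall f : smap K (X n), (forall g m x, f m (aK g m x) = rho g n m (f m x)) ->
      exists2 f' : smap L (X n),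
        forall g m x, f' m (aL g m x) = rho g n m (f' m x)
      & forall m x, f' m (i m x) = f m x.

End Actions.

Definition equivariant (G : groupType) (X Y : symSpec) (rX : G -> specMap X X)
    (rY : G -> specMap Y Y) (f : specMap X Y) : Prop :=
  forall g n m x, f n m (rX g n m x) = rY g n m (f n m x).

(* For [G] finite, acting on [X] through [rho], and [f : W -> X] with values in
   fixed points: the canonical map [W -> X^{hG}] is an equivalence, where
   [X^{hG}] is the fixed point spectrum of a fibrant replacement [X'] of [X]
   among [G]-spectra. *)
Definition homotopy_fixed_equiv (G : finGroupType) (X : symSpec)
    (rho : G -> specMap X X) (W : symSpec) (f : specMap W X) : Prop :=
  exists (X' : symSpec) (rho' : G -> specMap X' X') (j : specMap X X')
    (f' : specMap W (fix_spec rho')),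
    [/\ is_action rho', equivariantly_fibrant rho',
        equivariant rho rho' j /\ stable_equiv j,
        forall n m w, sval (f' n m w) = j n m (f n m w)
      & stable_equiv f'].

Section MapSpectrum.
Variables (T : Type) (X : symSpec).

Definition fun_act n m m' (d : delta m m') (x : T -> X n m') : T -> X n m :=
  fun g => sact d (x g).
Fact fun_act1 n m (x : T -> X n m) : fun_act (did m) x = x.
Proof. by apply: funext => g; rewrite /fun_act sact1. Qed.
Fact fun_actM n m m' m'' (f : delta m' m'') (g : delta m m') (x : T -> X n m'') :
  fun_act (dcomp f g) x = fun_act g (fun_act f x).
Proof. by apply: funext => h; rewrite /fun_act sactM. Qed.
Definition fun_sset n : sset :=
  @SSet (fun m => T -> X n m) (@fun_act n) (@fun_act1 n) (@fun_actM n).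

Fact fun_act_pt n m m' (d : delta m m') :
  sact (s := fun_sset n) d (fun=> pt) = (fun=> pt).
Proof. by apply: funext => g; rewrite /= /fun_act sact_pt. Qed.
Definition fun_psset n : psset := PSSet (@fun_act_pt n).

Definition fun_perm n m s (x : fun_psset n m) : fun_psset n m :=
  fun g => sperm s (x g).
Definition fun_sigma n m t (x : fun_psset n m) : fun_psset n.+1 m :=
  fun g => sigma t (x g).

Fact fun_sigma_iter p n m (t : 'I_p -> delta m 1) (x : fun_psset n m) g :
  sigma_iter (L := fun k => fun_psset k m) (fun k => @fun_sigma k m) t x g
  = sigma_iter (L := fun k => X k m) (fun k => @sigma X k m) t (x g).
Proof. by elim: p t => [|p IHp] t //=; rewrite /fun_sigma IHp. Qed.

(* [Map(T, X)] for a discrete space [T]. *)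
Definition fun_spec : symSpec.
Proof.
refine (@SymSpec fun_psset fun_perm fun_sigma _ _ _ _ _ _ _ _).
- by move=> n m m' d s x; apply: funext => g; apply: sperm_nat.
- by move=> n m s; apply: funext => g; apply: sperm_pt.
- by move=> n m x; apply: funext => g; apply: sperm1.
- by move=> n m s t x; apply: funext => g; apply: spermM.
- by move=> n m m' d t x; apply: funext => g; apply: sigma_nat.
- by move=> n m t; apply: funext => g; apply: sigma_pt.
- by move=> n m t x tB; apply: funext => g; apply: sigma_boundary.
- move=> p n m t r s x; apply: funext => g.
  by rewrite fun_sigma_iter /fun_perm sigma_equiv fun_sigma_iter.
Defined.

End MapSpectrum.

Definition acts_by_alg_maps (G : groupType) A (E : commAlg A)
    (rho : G -> specMap E E) : Prop :=
  is_action rho /\ forall g, is_alg_map (rho g).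

(* The canonical map [c : E /\_A E -> Map(G, E)] sends [x /\ y] to the function
   [g |-> x (g y)]. Since [Map(G, E)] is [k]-local, [c] extends, up to
   replacing [Map(G, E)] by a stably equivalent [N], to a map
   [h : (E /\_A E)_k -> N], which is unique up to homotopy. *)
Definition galois_map_equiv (k : symSpec) (G : finGroupType) A (E : commAlg A)
    (rho : G -> specMap E E) : Prop :=
  exists (P : symSpec) (b : bimorph E E P) (c : specMap P (fun_spec G E))
    (Pk : symSpec) (l : specMap P Pk) (N : symSpec)
    (j : specMap (fun_spec G E) N) (h : specMap Pk N),
    [/\ is_smash_over b,
        forall p q m (x : E p m) (y : E q m) g,
          c _ _ (bfun b x y) g = bfun amul x (rho g _ _ y),
        is_localization k l,
        stable_equiv j /\ (forall n m z, h n m (l n m z) = j n m (c n m z))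
      & stable_equiv h].

Definition galois_extension (k : symSpec) (G : finGroupType) A (E : commAlg A)
    (rho : G -> specMap E E) : Prop :=
  [/\ local k E, cofibrant_alg E, acts_by_alg_maps rho,
      exists2 u : specMap A E, is_unit_map u & homotopy_fixed_equiv rho u
    & galois_map_equiv k rho].

(* A directed system of finite [k]-local [G/U_a]-Galois extensions [E_a] of [A].
   The group [gal_quot a] is [G/U_a], on which [G] acts through the projection
   [gal_proj a]; [gal_sub b a] is the image [U_a/U_b] of [U_a] in [G/U_b]. *)
Record galois_system (k : symSpec) (G : profiniteGroupType) (A : commRing) :=
  GaloisSystem {
  gal_index : Type;
  gal_le : gal_index -> gal_index -> Prop;
  gal_inhabited : inhabited gal_index;
  gal_le_refl : forall a, gal_le a a;
  gal_le_trans : forall a b c, gal_le a b -> gal_le b c -> gal_le a c;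
  gal_directed : forall a b, exists2 c, gal_le a c & gal_le b c;

  gal_open : gal_index -> set G;
  gal_openP : forall a, open (gal_open a) /\ normal_subgroup (gal_open a);
  gal_open_le : forall a b, gal_le a b -> (gal_open b `<=` gal_open a)%classic;
  gal_cofinal : forall U : set G, open U -> normal_subgroup U ->
    exists a, (gal_open a `<=` U)%classic;

  gal_quot : gal_index -> finGroupType;
  gal_proj : forall a, {multiplicative G -> gal_quot a};
  gal_projP : forall a, is_quotient (gal_open a) (gal_proj a);

  gal_ext : gal_index -> commAlg A;
  gal_act : forall a, gal_quot a -> specMap (gal_ext a) (gal_ext a);
  gal_extP : forall a, galois_extension k (@gal_act a);

  gal_map : forall a b, gal_le a b -> specMap (gal_ext a) (gal_ext b);
  gal_map_id : forall a (e : gal_le a a) n m x, gal_map e n m x = x;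
  gal_map_comp : forall a b c (ab : gal_le a b) (bc : gal_le b c)
      (ac : gal_le a c) n m x,
    gal_map bc n m (gal_map ab n m x) = gal_map ac n m x;
  gal_map_equivariant : forall a b (ab : gal_le a b) g n m x,
    gal_map ab n m (gal_act (gal_proj a g) n m x)
    = gal_act (gal_proj b g) n m (gal_map ab n m x);
  gal_map_cofibration : forall a b (ab : gal_le a b), alg_cofibration (gal_map ab);

  gal_sub : forall b a, gal_le a b -> {group gal_quot b};
  gal_subP : forall b a (ab : gal_le a b) q,
    q \in gal_sub ab <-> exists2 u, gal_open a u & gal_proj b u = q;
  gal_map_fixed : forall a b (ab : gal_le a b),
    homotopy_fixed_equiv (G := subg_of (gal_sub ab))
      (fun q => gal_act (sgval q)) (gal_map ab) }.

Arguments gal_ext {k G A} D a : rename.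
Arguments gal_proj {k G A} D a : rename.

(* [E], with the cocone [iota], is the colimit of the system in commutative
   [A]-algebras. *)
Definition is_cocone k G A (D : galois_system k G A) (B : commAlg A)
    (f : forall a, specMap (gal_ext D a) B) : Prop :=
  (forall a, is_alg_map (f a)) /\
  (forall a b (ab : gal_le a b) n m x, f b n m (gal_map ab n m x) = f a n m x).

Definition is_colimit k G A (D : galois_system k G A) (E : commAlg A)
    (iota : forall a, specMap (gal_ext D a) E) : Prop :=
  is_cocone iota /\
  forall (B : commAlg A) (f : forall a, specMap (gal_ext D a) B), is_cocone f ->
    exists2 h : specMap E B,
      is_alg_map h /\ (forall a n m x, h n m (iota a n m x) = f a n m x)
    & forall h' : specMap E B, is_alg_map h' ->
        (forall a n m x, h' n m (iota a n m x) = f a n m x) ->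
        forall n m x, h' n m x = h n m x.

(* [rho] is the induced action: [rho g] is the map of commutative [A]-algebras
   induced on colimits by the action of [g] on the system. *)
Definition profinite_galois_extension (k : symSpec) (G : profiniteGroupType)
    (A : commRing) (E : commAlg A) (rho : G -> specMap E E) : Prop :=
  exists (D : galois_system k G A) (iota : forall a, specMap (gal_ext D a) E),
    is_colimit iota /\
    forall g, is_alg_map (rho g) /\
      forall a n m x,
        rho g n m (iota a n m x) = iota a n m (gal_act (gal_proj D a g) n m x).

(* That the spheres carry the trivial action is part of [rho] being a family of
   maps of symmetric spectra. *)
Definition discrete_spectrum (G : profiniteGroupType) (X : symSpec)
    (rho : G -> specMap X X) : Prop :=
  is_action rho /\
  forall n m (x : X n m), open [set g | rho g n m x = x]%classic.

Definition discrete_module (G : profiniteGroupType) A (M : module A)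
    (rho : G -> specMap M M) : Prop :=
  discrete_spectrum rho /\ forall g, is_module_map (rho g).

Definition discrete_comm_algebra (G : profiniteGroupType) A (E : commAlg A)
    (rho : G -> specMap E E) : Prop :=
  discrete_module rho /\ forall g, is_alg_map (rho g).

(* Main.v *)
(* Every simplex in the image of some [E_a] is fixed by the open subgroup [U_a].
   The simplices of [E] fixed by a neighbourhood of [1] form a commutative
   [A]-subalgebra of [E] through which the whole cocone factors, so by the
   universal property of the colimit the inclusion of this subalgebra admits a
   section and it is all of [E]. This avoids computing colimits of commutative
   algebras on underlying simplicial sets. *)
From mathcomp Require Import all_boot fingroup.
From mathcomp Require Import boolp classical_sets topology.
Require Import Defs.

Set Implicit Arguments.
Unset Strict Implicit.
Unset Printing Implicit Defensive.

(** * Identities and composites of maps, and their compatibility with [twist] *)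

Definition spec_id (X : symSpec) : specMap X X :=
  @SpecMap X X (fun _ _ x => x) (fun _ _ _ _ _ => erefl) (fun _ _ => erefl)
    (fun _ _ _ _ => erefl) (fun _ _ _ _ => erefl).

Lemma mfun_lcast (X Y : symSpec) (f : specMap X Y) n n' m (e : n = n') (x : X n m) :
  f _ _ (lcast e x) = lcast e (f _ _ x).
Proof. by case: n' / e. Qed.

Lemma mfun_twist (X Y : symSpec) (f : specMap X Y) p q m (x : X (p + q) m) :
  f _ _ (twist x) = twist (f _ _ x).
Proof. by rewrite /twist mfun_perm mfun_lcast. Qed.

Lemma is_alg_map_id A (E : commAlg A) : is_alg_map (spec_id E).
Proof. by split. Qed.

Lemma is_alg_map_comp A (E F H : commAlg A) (g : specMap F H) (f : specMap E F) :
  is_alg_map g -> is_alg_map f -> is_alg_map (spec_comp g f).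
Proof.
move=> [gZ gM g1] [fZ fM f1]; split=> [p q m a x|p q m x y|m] /=.
- by rewrite fZ gZ.
- by rewrite fM gM.
- by rewrite f1 g1.
Qed.

(** * Subspectra, given by predicates on simplices *)

Record subspectrum (X : symSpec) := Subspectrum {
  in_sub :> forall n m, X n m -> Prop;
  sub_sact : forall n m m' (d : delta m m') (x : X n m'), in_sub x -> in_sub (sact d x);
  sub_pt : forall n m, in_sub (pt : X n m);
  sub_sperm : forall n m s (x : X n m), in_sub x -> in_sub (sperm s x);
  sub_sigma : forall n m t (x : X n m), in_sub x -> in_sub (sigma t x) }.

Section SubSpectrum.
Variables (X : symSpec) (S : subspectrum X).

Definition sub_simp n m := {x : X n m | S n m x}.

Lemma sub_eq n m (x y : sub_simp n m) : sval x = sval y -> x = y.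
Proof.
by case: x y => [x xP] [y yP] /= E; subst; congr exist; apply: Prop_irrelevance.
Qed.

Definition sub_act n m m' (d : delta m m') (x : sub_simp n m') : sub_simp n m :=
  exist _ _ (sub_sact d (svalP x)).

Fact sub_act1 n m (x : sub_simp n m) : sub_act (did m) x = x.
Proof. by apply: sub_eq; rewrite /= sact1. Qed.
Fact sub_actM n m m' m'' (f : delta m' m'') (g : delta m m') (x : sub_simp n m'') :
  sub_act (dcomp f g) x = sub_act g (sub_act f x).
Proof. by apply: sub_eq; rewrite /= sactM. Qed.
Definition sub_sset n : sset := SSet (@sub_act1 n) (@sub_actM n).

Definition sub_base n m : sub_sset n m := exist _ _ (sub_pt S n m).
Fact sub_act_pt n m m' (d : delta m m') : sact d (sub_base n m') = sub_base n m.
Proof. by apply: sub_eq; rewrite /= sact_pt. Qed.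
Definition sub_psset n : psset := PSSet (@sub_act_pt n).

Definition sub_perm n m s (x : sub_psset n m) : sub_psset n m :=
  exist _ _ (sub_sperm s (svalP x)).
Definition sub_susp n m t (x : sub_psset n m) : sub_psset n.+1 m :=
  exist _ _ (sub_sigma t (svalP x)).

Fact sub_sigma_iter p n m (t : 'I_p -> delta m 1) (x : sub_psset n m) :
  sval (sigma_iter (L := fun k => sub_psset k m) (fun k => @sub_susp k m) t x)
  = sigma_iter (L := fun k => X k m) (fun k => @sigma X k m) t (sval x).
Proof. by elim: p t => [|p IHp] t //=; rewrite IHp. Qed.

Definition sub_spec : symSpec.
Proof.
refine (@SymSpec sub_psset sub_perm sub_susp _ _ _ _ _ _ _ _).
- by move=> n m m' d s x; apply: sub_eq; rewrite /= sperm_nat.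
- by move=> n m s; apply: sub_eq; rewrite /= sperm_pt.
- by move=> n m x; apply: sub_eq; rewrite /= sperm1.
- by move=> n m s t x; apply: sub_eq; rewrite /= spermM.
- by move=> n m m' d t x; apply: sub_eq; rewrite /= sigma_nat.
- by move=> n m t; apply: sub_eq; rewrite /= sigma_pt.
- by move=> n m t x tB; apply: sub_eq; rewrite /= sigma_boundary.
- move=> p n m t r s x; apply: sub_eq.
  by rewrite sub_sigma_iter /= sigma_equiv sub_sigma_iter.
Defined.

Definition sub_incl : specMap sub_spec X :=
  @SpecMap sub_spec X (fun _ _ x => sval x) (fun _ _ _ _ _ => erefl)
    (fun _ _ => erefl) (fun _ _ _ _ => erefl) (fun _ _ _ _ => erefl).

Lemma sub_incl_inj n m : injective (sub_incl n m).
Proof. by move=> x y; apply: sub_eq. Qed.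

Definition corestrict (Y : symSpec) (f : specMap Y X)
  (fS : forall n m y, S n m (f n m y)) : specMap Y sub_spec.
Proof.
refine (@SpecMap Y sub_spec (fun n m y => exist _ _ (fS n m y)) _ _ _ _).
- by move=> n m m' d x; apply: sub_eq; rewrite /= mfun_nat.
- by move=> n m; apply: sub_eq; rewrite /= mfun_pt.
- by move=> n m s x; apply: sub_eq; rewrite /= mfun_perm.
- by move=> n m t x; apply: sub_eq; rewrite /= mfun_sigma.
Defined.

(** The maps [f] and [g] allow either variable to be restricted: the action of [A] keeps its first
    variable ([f] is the identity), while the multiplication restricts both to the subspectrum. *)
Definition sub_bimorph (V W V' W' : symSpec) (b : bimorph V W X)
  (f : specMap V' V) (g : specMap W' W)
  (bS : forall p q m (x : V' p m) (y : W' q m), S _ _ (bfun b (f _ _ x) (g _ _ y))) :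
  bimorph V' W' sub_spec.
Proof.
refine (@Bimorph V' W' sub_spec (fun p q m x y => exist _ _ (bS p q m x y))
  _ _ _ _ _ _).
- by move=> p q m m' d x y; apply: sub_eq; rewrite /= !mfun_nat bfun_nat.
- by move=> p q m y; apply: sub_eq; rewrite /= mfun_pt bfun_ptl.
- by move=> p q m x; apply: sub_eq; rewrite /= mfun_pt bfun_ptr.
- by move=> p q m s r x y; apply: sub_eq; rewrite /= !mfun_perm bfun_perm.
- by move=> p q m t x y; apply: sub_eq; rewrite /= mfun_sigma bfun_sigmal.
(* Here [twist] transports along an equality of levels, so the inclusion is moved past it by
   [mfun_twist]. On the left the levels [q.+1 + p] and [(q + p).+1] are identified by conversion,
   whence the explicit instance. *)
- move=> p q m t x y; apply: sub_incl_inj.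
  rewrite (mfun_sigma sub_incl) mfun_twist.
  apply: (etrans (@mfun_twist _ _ sub_incl p q.+1 m _)).
  by have := bfun_sigmar b t (f _ _ x) (g _ _ y); rewrite -(mfun_sigma g).
Defined.

End SubSpectrum.

(** * Subalgebras of a commutative [A]-algebra *)

Section SubAlgebra.
Variables (A : commRing) (E : commAlg A) (S : subspectrum E).
Hypothesis subZ : forall p q m (a : A p m) (x : E q m),
  S _ _ x -> S _ _ (bfun mact a x).
Hypothesis subM : forall p q m (x : E p m) (y : E q m),
  S _ _ x -> S _ _ y -> S _ _ (bfun amul x y).
Hypothesis sub1 : forall m, S 0 m aone.

Definition sub_module : module A.
Proof.
refine (@Module A (sub_spec S)
  (sub_bimorph (b := mact) (f := spec_id A) (g := sub_incl S)
     (fun p q m a x => subZ a (svalP x))) _ _).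
- by move=> p m x; apply: sub_eq; rewrite /= mact1.
- by move=> p q r m a b x; apply: sub_incl_inj; rewrite mfun_lcast /= mactA.
Defined.

Definition sub_alg : commAlg A.
Proof.
refine (@CommAlg A sub_module
  (sub_bimorph (b := amul) (f := sub_incl S) (g := sub_incl S)
     (fun p q m x y => subM (svalP x) (svalP y)))
  (fun m => exist _ _ (sub1 m)) _ _ _ _ _).
- by move=> m m' d; apply: sub_eq; rewrite /= aone_nat.
- by move=> p m x; apply: sub_eq; rewrite /= amul1.
- by move=> p q r m x y z; apply: sub_incl_inj; rewrite mfun_lcast /= amulA.
- by move=> p q m x y; apply: sub_incl_inj; rewrite mfun_twist /= amulC.
- by move=> p q r m a x y; apply: sub_incl_inj; rewrite mfun_lcast /= amulZ.
Defined.

Lemma is_alg_map_sub_incl : is_alg_map (E := sub_alg) (F := E) (sub_incl S).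
Proof. by split. Qed.

Lemma is_alg_map_corestrict (F : commAlg A) (f : specMap F E)
    (fS : forall n m y, S n m (f n m y)) :
  is_alg_map f -> is_alg_map (F := sub_alg) (corestrict fS).
Proof.
move=> [fZ fM f1]; split=> [p q m a x|p q m x y|m]; apply: sub_eq.
- exact: fZ.
- exact: fM.
- exact: f1.
Qed.

End SubAlgebra.

(** * Consequences of the universal property of the colimit *)

Section Colimit.
Variables (k : symSpec) (G : profiniteGroupType) (A : commRing).
Variables (D : galois_system k G A) (E : commAlg A).
Variable iota : forall a, specMap (gal_ext D a) E.
Hypothesis iota_colim : is_colimit iota.

(** Both maps extend the cocone [spec_comp g (iota a)], so each equals the map that it induces. *)
Lemma colimit_eq (f g : specMap E E) :
  is_alg_map f -> is_alg_map g ->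
  (forall a n m x, f n m (iota a n m x) = g n m (iota a n m x)) ->
  forall n m x, f n m x = g n m x.
Proof.
move=> fA gA fg n m x; case: iota_colim => [[iotaA iota_comp] colim].
have [|h _ h_uniq] := colim E (fun a => spec_comp g (iota a)).
  split=> [a|a b ab i j y /=]; first exact: is_alg_map_comp.
  by rewrite iota_comp.
by rewrite (h_uniq f) // (h_uniq g).
Qed.

(** An induction principle for [E]: a property stable under the algebra operations need only be
    checked on the images of the [iota a]. *)
Lemma colimit_subalgebra (S : subspectrum E) :
  (forall p q m (a : A p m) (x : E q m), S _ _ x -> S _ _ (bfun mact a x)) ->
  (forall p q m (x : E p m) (y : E q m),
     S _ _ x -> S _ _ y -> S _ _ (bfun amul x y)) ->
  (forall m, S 0 m aone) ->
  (forall a n m x, S n m (iota a n m x)) ->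
  forall n m x, S n m x.
Proof.
move=> SZ SM S1 Siota n m x; case: (iota_colim) => [[iotaA iota_comp] colim].
have [|h [hA h_iota] _] :=
  colim (sub_alg SZ SM S1) (fun a => corestrict (Siota a)).
  split=> [a|a b ab i j y]; first exact: is_alg_map_corestrict.
  by apply: sub_eq; apply: iota_comp.
(* A value of the inclusion carries its own proof of membership, so it remains to see that [h] is a
   section. *)
suff -> : x = sub_incl S n m (h n m x) by apply: svalP.
apply: (colimit_eq (f := spec_id E) (g := spec_comp (sub_incl S) h)).
- exact: is_alg_map_id.
- exact: is_alg_map_comp (is_alg_map_sub_incl SZ SM S1) hA.
- by move=> a i j y /=; rewrite h_iota.
Qed.

End Colimit.

(** * Simplices with stabilizer a neighbourhood of the identity *)

Section Smooth.
Variables (G : profiniteGroupType) (X : symSpec) (rho : G -> specMap X X).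

Definition stabilizer n m (x : X n m) : set G := [set g | rho g n m x = x]%classic.

(** Stated with neighbourhoods of [1] rather than openness, so that closure under operations needs
    only the filter laws: supersets and finite intersections. *)
Definition smooth n m (x : X n m) : Prop := nbhs (1%g : G) (stabilizer x).

Lemma smooth_fixed n m (x : X n m) : (forall g, rho g n m x = x) -> smooth x.
Proof. by move=> fx; apply: filterS filterT => g _; apply: fx. Qed.

Definition smooth_subspectrum : subspectrum X.
Proof.
refine (@Subspectrum X smooth _ _ _ _).
- by move=> n m m' d x; apply: filterS => g /= gx; rewrite /stabilizer /= mfun_nat gx.
- by move=> n m; apply: smooth_fixed => g; rewrite mfun_pt.
- by move=> n m s x; apply: filterS => g /= gx; rewrite /stabilizer /= mfun_perm gx.
- by move=> n m t x; apply: filterS => g /= gx; rewrite /stabilizer /= mfun_sigma gx.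
Defined.

Lemma translate_continuous (g : G) : continuous (fun h : G => (g * h)%g).
Proof.
move=> h; apply: (@continuous_comp G (G * G)%type G (fun h => (g, h))
  (fun z => (z.1 * z.2)%g)); last exact: mulg_continuous.
by apply: cvg_pair; [exact: cvg_cst | exact: cvg_id].
Qed.

(** Left translation carries the neighbourhood of [1] to one of any [g] in the stabilizer. *)
Lemma smooth_open n m (x : X n m) :
  is_action rho -> smooth x -> open (stabilizer x).
Proof.
move=> [rho1 rhoM] sx; rewrite openE => g gx.
(* This preimage is the coset of the stabilizer through [g]; writing [h] as [g * (g^-1 * h)] shows
   that it fixes [x]. *)
have near_g : nbhs g ((fun h => (g^-1 * h)%g) @^-1` stabilizer x)%classic.
  by apply: (@translate_continuous (g^-1)%g g); rewrite mulVg.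
apply: (filterS _ near_g) => h /= hx.
by rewrite /stabilizer /= -[h](mulKVg g) rhoM hx.
Qed.

End Smooth.

Theorem proposition6p2p3 (k T M : symSpec)
  (T_smashing : smashing T) (M_finite : finite_spectrum M)
  (k_composite : composite_localization k T M)
  (G : profiniteGroupType)
  (A : commRing) (A_local : local k A) (A_cofibrant : cofibrant_ring A)
  (E : commAlg A) (rho : G -> specMap E E)
  (E_galois : profinite_galois_extension k rho) :
  discrete_comm_algebra rho.
Proof.
case: E_galois => D [iota [colim rhoP]].
have rhoA g : is_alg_map (rho g) by case: (rhoP g).
have rho_iota g a n m x :
    rho g n m (iota a n m x) = iota a n m (gal_act (gal_proj D a g) n m x).
  by case: (rhoP g).
have act_action a : is_action (@gal_act k G A D a).
  by case: (@gal_extP k G A D a) => _ _ [].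
have projU a g : gal_open a g -> gal_proj D a g = 1%g.
  by case: (@gal_projP k G A D a) => _ /(_ g) [].
have open1 (a : gal_index D) : gal_open a 1%g.
  by case: (@gal_openP k G A D a) => _ [].
(* The action laws hold on each [gal_ext D a] and pass to [E] because algebra maps out of [E] are
   determined on the cocone. *)
have rho_action : is_action rho.
  split=> [|g h].
    apply: (colimit_eq colim (g := spec_id E)) => //= a n m x.
    by rewrite rho_iota projU // (act_action a).1.
  apply: (colimit_eq colim (g := spec_comp (rho g) (rho h))) => //.
    exact: is_alg_map_comp.
  by move=> a n m x /=; rewrite !rho_iota gmulfM (act_action a).2.
split=> //; split; last by move=> g; case: (rhoA g).
split=> //.
move=> n m x; apply: smooth_open => //.
apply: (colimit_subalgebra colim (S := smooth_subspectrum rho)).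
(* By [A]-linearity of [rho g], whatever fixes [y] fixes [a y]. *)
- move=> p q i a y; apply: filterS => g gy.
  by case: (rhoA g) => rZ _ _; rewrite /stabilizer /= rZ gy.
- move=> p q i y z; rewrite /= /smooth => sy sz.
  (* The intersection of the two stabilizers fixes the product. *)
  apply: (filterS _ (filterI sy sz)) => g [gy gz].
  by case: (rhoA g) => _ rM _; rewrite /stabilizer /= rM gy gz.
- by move=> i; apply: smooth_fixed => g; case: (rhoA g).
(* The open subgroup [gal_open a] is the kernel of [gal_proj D a], so it fixes the image of [iota a]
   pointwise. *)
move=> a i j y; have [Uo _] := @gal_openP k G A D a.
apply: (filterS _ (open_nbhs_nbhs (conj Uo (open1 a)))) => g Ug.
by rewrite /stabilizer /= rho_iota projU // (act_action a).1.
Qed.
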